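(* Let $(M,h)$ be a Riemannian spin surface, let $\Omega\subset M$ be a connected domain with local coordinates $x,y$ and coordinate vector fields $\partial_x,\partial_y$, let $\phi\colon\Omega\to S^n\subset\mathbb{R}^{n+1}$ be smooth, and let $\psi$ be a smooth section of $\Sigma M\otimes\phi^\ast TS^n$ over $\Omega$. For $\alpha\in\{x,y\}$ and $i,m\in\{1,\dots,n+1\}$ put $$J_\alpha^{im}:=\operatorname{Re}\langle \partial_\alpha\cdot\psi^i,\psi^m\rangle_{\Sigma M}+(\phi^i_\alpha\phi^m-\phi^i\phi^m_\alpha).$$ Then, with summation over $j$, $$\begin{aligned} \partial_x J_y^{im}&-\partial_y J_x^{im}-2(J^{ij}_x J^{jm}_y-J^{ij}_y J^{jm}_x) \\ =&-\operatorname{Re}\langle (\partial_x\cdot\nabla_{\partial_y}-\partial_y\cdot\nabla_{\partial_x})\psi^i,\psi^m\rangle_{\Sigma M} +\operatorname{Re}\langle\psi^i,(\partial_x\cdot\nabla_{\partial_y}-\partial_y\cdot\nabla_{\partial_x})\psi^m\rangle_{\Sigma M} \\ &-2\big(\operatorname{Re}\langle\psi^i,\partial_x\cdot\psi^j\rangle_{\Sigma M}\operatorname{Re}\langle\psi^j,\partial_y\cdot\psi^m\rangle_{\Sigma M} -\operatorname{Re}\langle\psi^i,\partial_y\cdot\psi^j\rangle_{\Sigma M}\operatorname{Re}\langle\psi^j,\partial_x\cdot\psi^m\rangle_{\Sigma M} \\ &\quad-\operatorname{Re}\langle\psi^i,\partial_x\cdot\psi^j\rangle_{\Sigma M}\phi^j_y\phi^m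 +\operatorname{Re}\langle\psi^j,\partial_y\cdot\psi^m\rangle_{\Sigma M}\phi^i\phi^j_x \\ &\quad+\operatorname{Re}\langle\psi^i,\partial_y\cdot\psi^j\rangle_{\Sigma M}\phi^j_x\phi^m -\operatorname{Re}\langle\psi^j,\partial_x\cdot\psi^m\rangle_{\Sigma M}\phi^i\phi^j_y\big). \end{aligned}$$
   Context: $\Sigma M$ is the spinor bundle of $(M,h)$ with hermitian scalar product $\langle\cdot,\cdot\rangle_{\Sigma M}$ and metric spin connection $\nabla$ (compatible with Clifford multiplication and the Levi-Civita connection). Clifford multiplication by tangent vectors is skew-symmetric, $\langle\psi,X\cdot\eta\rangle=-\langle X\cdot\psi,\eta\rangle$, and satisfies $X\cdot Y\cdot\psi+Y\cdot X\cdot\psi=-2h(X,Y)\psi$. A map to $S^n$ is written $\phi=(\phi^1,\dots,\phi^{n+1})$ with $|\phi|=1$; $\phi^j_x=\partial_x\phi^j$, $\phi^j_y=\partial_y\phi^j$. A section $\psi$ of $\Sigma M\otimes\phi^\ast TS^n$ is written $\psi=(\psi^1,\dots,\psi^{n+1})$ with each $\psi^i$ a section of $\Sigma M$ and $\sum_i\phi^i\psi^i=0$. *)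

(* Defs.v *)
From HB Require Import structures.
From mathcomp Require Import all_boot all_order all_algebra.
From mathcomp Require Import ring complex.
From mathcomp Require Import all_classical all_reals all_analysis.

Set Implicit Arguments.
Unset Strict Implicit.
Unset Printing Implicit Defensive.

Import Order.TTheory GRing.Theory Num.Theory.
Import numFieldNormedType.Exports.

Local Open Scope classical_set_scope.
Local Open Scope ring_scope.
Local Open Scope complex_scope.

(* Conventions: coordinates and tangent vectors are row vectors, so components
   change from a chart c to a chart d by right multiplication with the library
   Jacobian 'J of the transition map, and a frame is a matrix whose rows are
   the frame vectors. Spinors are column vectors. *)

Section Plane.
Context {R : realType}.

Definition bvec (k : 'I_2) : 'rV[R]_2 := delta_mx 0 k.

Fixpoint Ck (k : nat) (U : set 'rV[R]_2) (f : 'rV[R]_2 -> R) : Prop :=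
  (forall x, U x -> {for x, continuous f}) /\
  if k is k'.+1 then
    forall i : 'I_2, (forall x, U x -> derivable f x (bvec i)) /\
                     Ck k' U (fun x => 'D_(bvec i) f x)
  else True.

Definition smooth_plane (U : set 'rV[R]_2) (f : 'rV[R]_2 -> R) : Prop :=
  forall k, Ck k U f.

End Plane.

Section Charts.
Context {R : realType}.

(* [coord] and [cinv] are total; only their values on [cdom] and on the image
   [coord @` cdom] are meaningful. *)
Record chart (M : topologicalType) := Chart {
  cdom : set M;
  coord : M -> 'rV[R]_2;
  cinv : 'rV[R]_2 -> M;
  cdom_open : open cdom;
  cimg_open : open (coord @` cdom);
  coordK : forall p, cdom p -> cinv (coord p) = p;
  coord_continuous : forall p, cdom p -> {for p, continuous coord};
  cinv_continuous : forall p, cdom p -> {for coord p, continuous cinv} }.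

Definition transition (M : topologicalType) (c d : chart M) :
  'rV[R]_2 -> 'rV[R]_2 := coord d \o cinv c.

Definition compatible (M : topologicalType) (c d : chart M) : Prop :=
  forall i : 'I_2, smooth_plane (coord c @` (cdom c `&` cdom d))
                                (fun x => transition c d x 0 i).

End Charts.

Arguments chart : clear implicits.

Record surface (R : realType) := Surface {
  surface_carrier :> topologicalType;
  surface_hausdorff : hausdorff_space surface_carrier;
  surface_countable : @second_countable surface_carrier;
  charts : set (chart R surface_carrier);
  charts_cover : forall p, exists2 c, charts c & cdom c p;
  charts_compatible : forall c d, charts c -> charts d -> compatible c d;
  charts_maximal : forall c,
    (forall d, charts d -> compatible c d /\ compatible d c) -> charts c }.

Section Calculus.
Context {R : realType} {M : surface R}.
Implicit Types (c d : chart R M) (p : M).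

Definition smooth_on (W : set M) (f : M -> R) : Prop :=
  forall c, charts c ->
    smooth_plane (coord c @` (W `&` cdom c)) (f \o cinv c).

(* The derivative of f at p along the k-th coordinate vector field of c. *)
Definition pd c (k : 'I_2) (f : M -> R) p : R :=
  'D_(bvec k) (f \o cinv c) (coord c p).

Definition jac c d p : 'M[R]_2 := 'J (transition c d) (coord c p).

End Calculus.

Record metric (R : realType) (M : surface R) := Metric {
  gmx : chart R M -> M -> 'M[R]_2;
  gmx_smooth : forall c, charts c ->
    forall i j, smooth_on (cdom c) (fun p => gmx c p i j);
  gmx_sym : forall c p, charts c -> cdom c p -> (gmx c p)^T = gmx c p;
  gmx_pos : forall c p, charts c -> cdom c p ->
    forall v : 'rV[R]_2, v != 0 -> 0 < (v *m gmx c p *m v^T) 0 0;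
  gmx_tensor : forall c d p, charts c -> charts d ->
    cdom c p -> cdom d p ->
    gmx c p = jac c d p *m gmx d p *m (jac c d p)^T }.

Section LeviCivita.
Context {R : realType} {M : surface R} (h : metric M).
Implicit Types (c : chart R M) (p : M).

Definition christoffel c p (l i j : 'I_2) : R :=
  2^-1 * \sum_(m < 2) invmx (gmx h c p) l m *
    (pd c i (fun q => gmx h c q m j) p + pd c j (fun q => gmx h c q m i) p
     - pd c m (fun q => gmx h c q i j) p).

(* Components in c of the covariant derivative along the k-th coordinate
   vector field of the vector field with components X in c. *)
Definition lc_nabla c (k : 'I_2) (X : M -> 'rV[R]_2) p : 'rV[R]_2 :=
  \row_l (pd c k (fun q => X q 0 l) p
          + \sum_(m < 2) christoffel c p l k m * X p 0 m).

Definition inner c p (X Y : 'rV[R]_2) : R := (X *m gmx h c p *m Y^T) 0 0.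

End LeviCivita.

Section Spin2.
Context {R : realType}.

(* The complex representation of Cl_2: gamma j is skew-Hermitian and
   gamma i gamma j + gamma j gamma i = - 2 delta_ij. *)
Definition gamma (j : 'I_2) : 'M[R[i]]_2 :=
  if j == 0 then \matrix_(k, l) (if k == l then 0 else 0 +i* 1)
  else \matrix_(k, l) (if k == l then 0 else if k == 0 then 1 else -1).

(* Spin(2) is the set of a + b e_1 e_2 in Cl_2 with a^2 + b^2 = 1, encoded as
   the unit complex number z = a + i b, with the same product. *)
Definition spin_rep (z : R[i]) : 'M[R[i]]_2 :=
  ((complex.Re z)%:C)%:M + (complex.Im z)%:C *: (gamma 0 *m gamma 1).

(* The covering Spin(2) -> SO(2), v |-> s v s^-1: row j holds the components
   of s e_j s^-1. *)
Definition spin_cov (z : R[i]) : 'M[R]_2 :=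
  \matrix_(j, k) (if j == k then complex.Re (z ^+ 2)
                  else if j == 0 then complex.Im (z ^+ 2)
                  else - complex.Im (z ^+ 2)).

Lemma gamma0E (u : 'cV[R[i]]_2) (k : 'I_2) :
  (gamma 0 *m u) k 0 = (0 +i* 1) * u (k + 1) 0.
Proof.
rewrite mxE big_ord_recl big_ord1 /gamma eqxx !mxE.
by case: k => -[|[]] // hk /=; rewrite mul0r ?add0r ?addr0;
  congr (_ * u _ 0); apply/val_inj.
Qed.

Lemma gamma1E (u : 'cV[R[i]]_2) (k : 'I_2) :
  (gamma 1 *m u) k 0 = (if k == 0 then 1 else -1) * u (k + 1) 0.
Proof.
rewrite mxE big_ord_recl big_ord1 /gamma /= !mxE.
by case: k => -[|[]] // hk /=; rewrite mul0r ?add0r ?addr0;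
  congr (_ * u _ 0); apply/val_inj.
Qed.

Lemma spin_repE (z : R[i]) (u : 'cV[R[i]]_2) (k : 'I_2) :
  (spin_rep z *m u) k 0 = (if k == 0 then conjc z else z) * u k 0.
Proof.
rewrite mulmxDl mul_scalar_mx -scalemxAl -mulmxA 2![in LHS]mxE.
rewrite [X in _ + X]mxE gamma0E gamma1E -addrA.
have -> : 1 + 1 = 0 :> 'I_2 by apply/val_inj.
rewrite addr0 !mulrA -mulrDl; congr (_ * _); case: z => a b.
by case: k => -[|[]] // hk /=; simpc.
Qed.

End Spin2.

(* A spin structure given by local trivializations: an open cover of M by
   domains [sdom a] with orthonormal frames [frame a] (row j of [frame a c p]
   holds the components in the chart c of the j-th frame vector at p), whose
   changes of frame are SO(2)-valued and are lifted to a Spin(2)-valued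
   cocycle [slift]. The frames make M oriented. *)
Record spin_structure (R : realType) (M : surface R) (h : metric M) :=
    SpinStructure {
  sidx : Type;
  sdom : sidx -> set M;
  sdom_open : forall a, open (sdom a);
  sdom_cover : forall p, exists a, sdom a p;
  frame : sidx -> chart R M -> M -> 'M[R]_2;
  frame_smooth : forall a c, charts c ->
    forall j k, smooth_on (sdom a `&` cdom c) (fun p => frame a c p j k);
  frame_tensor : forall a c d p, charts c -> charts d ->
    sdom a p -> cdom c p -> cdom d p ->
    frame a d p = frame a c p *m jac c d p;
  frame_orthonormal : forall a c p, charts c -> sdom a p -> cdom c p ->
    frame a c p *m gmx h c p *m (frame a c p)^T = 1%:M;
  slift : sidx -> sidx -> M -> R[i];
  slift_smooth : forall a b,
    smooth_on (sdom a `&` sdom b) (fun p => complex.Re (slift a b p)) /\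
    smooth_on (sdom a `&` sdom b) (fun p => complex.Im (slift a b p));
  slift_unit : forall a b p, sdom a p -> sdom b p ->
    complex.Re (slift a b p) ^+ 2 + complex.Im (slift a b p) ^+ 2 = 1;
  slift_frame : forall a b c p, charts c ->
    sdom a p -> sdom b p -> cdom c p ->
    frame b c p = spin_cov (slift a b p) *m frame a c p;
  slift_cocycle : forall a b c p, sdom a p -> sdom b p -> sdom c p ->
    slift a b p * slift b c p = slift a c p }.

Section Spinors.
Context {R : realType} {M : surface R} {h : metric M} (S : spin_structure h).
Implicit Types (c : chart R M) (p : M).

(* The spinor bundle is the bundle associated with the spin structure and
   [spin_rep]. An element of its fibre at p is given by its components
   [u a] in all the trivializations a over p, related by [is_spinor]. *)
Definition spinor : Type := sidx S -> 'cV[R[i]]_2.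

Definition is_spinor p (u : spinor) : Prop :=
  forall a b, sdom a p -> sdom b p -> u a = spin_rep (slift a b p) *m u b.

Definition smooth_section (W : set M) (psi : M -> spinor) : Prop :=
  (forall p, W p -> is_spinor p (psi p)) /\
  forall a (k : 'I_2),
    smooth_on (W `&` sdom a) (fun p => complex.Re (psi p a k 0)) /\
    smooth_on (W `&` sdom a) (fun p => complex.Im (psi p a k 0)).

Definition cdot (u v : 'cV[R[i]]_2) : R[i] := \sum_k u k 0 * conjc (v k 0).

(* Evaluated in some trivialization over p; see [hermE] for independence. *)
Definition herm p (u v : spinor) : R[i] :=
  let a := projT1 (cid (sdom_cover S p)) in cdot (u a) (v a).

Lemma hermE p a (u v : spinor) : sdom a p -> is_spinor p u -> is_spinor p v ->
  herm p u v = cdot (u a) (v a).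
Proof.
move=> pa su sv; rewrite /herm; case: cid => b pb /=.
rewrite (su b a pb pa) (sv b a pb pa) /cdot.
have zz : slift b a p * conjc (slift b a p) = 1.
  case: (slift b a p) (slift_unit pb pa) => x y /= xy.
  by simpc; rewrite -!expr2 xy [y * x]mulrC addNr.
apply: eq_bigr => k _; rewrite !spin_repE rmorphM /= mulrACA.
case: ifP => _; last by rewrite zz mul1r.
by rewrite conjcK [X in X * _]mulrC zz mul1r.
Qed.

(* Clifford multiplication at p by the tangent vector with components X in c. *)
Definition clifford c p (X : 'rV[R]_2) (u : spinor) : spinor :=
  fun a => \sum_(j < 2)
    (inner h c p X (row j (frame a c p)))%:C *: (gamma j *m u a).

Lemma clifford_spinor c p X u : charts c -> cdom c p ->
  is_spinor p u -> is_spinor p (clifford c p X u).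
Proof.
move=> hc pc su a b pa pb; rewrite /clifford (su a b pa pb).
have Fb k : inner h c p X (row k (frame b c p)) =
    \sum_(j < 2) spin_cov (slift a b p) k j *
                 inner h c p X (row j (frame a c p)).
  rewrite (slift_frame hc pa pb pc) row_mul.
  rewrite (_ : row k _ *m _ = \sum_(j < 2)
    spin_cov (slift a b p) k j *: row j (frame a c p)); last first.
    by rewrite mulmx_sum_row; apply: eq_bigr => j _; rewrite mxE.
  rewrite /inner linear_sum mulmx_sumr summxE; apply: eq_bigr => j _.
  by rewrite linearZ /= -scalemxAr mxE.
apply/matrixP => k l; rewrite [l]ord1 {l}.
have ZE (z : R[i]) (v : 'cV[R[i]]_2) j : (z *: v) j 0 = z * v j 0.
  by rewrite mxE.
rewrite spin_repE !summxE !big_ord_recl !big_ord0 !addr0 !ZE.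
rewrite (_ : lift ord0 ord0 = 1); last by apply/val_inj.
rewrite !gamma0E !gamma1E !spin_repE !Fb !big_ord_recl !big_ord0 !addr0.
rewrite (_ : lift ord0 ord0 = 1); last by apply/val_inj.
move: (inner _ _ _ _ _) (inner _ _ _ _ _) (slift_unit pa pb) => y0 y1.
rewrite !mxE /= expr2.
case: (slift a b p) => z w /= zw; simpc.
have scale1 e f : f = e * (z * z + w ^+ 2) -> e = f by rewrite zw mulr1.
by case: k => -[|[]] // hk /=; case: (u b _ 0) => r s; simpc;
  congr Complex; apply: scale1; ring.
Qed.

(* The spin connection along the k-th coordinate vector field of c:
   d_k psi + 1/4 sum_(i, j) h (nabla_k e_i, e_j) e_i . e_j . psi *)
Definition spin_nabla c (k : 'I_2) (psi : M -> spinor) p : spinor :=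
  fun a =>
    \col_l (pd c k (fun q => complex.Re (psi q a l 0)) p
            +i* pd c k (fun q => complex.Im (psi q a l 0)) p)
    + \sum_(i < 2) \sum_(j < 2)
        (4^-1 * inner h c p (lc_nabla h c k (fun q => row i (frame a c q)) p)
                            (row j (frame a c p)))%:C
        *: (gamma i *m (gamma j *m psi p a)).

(* (d_x . nabla_y - d_y . nabla_x) psi, for the coordinates (x, y) of c. *)
Definition dirac_curl c (psi : M -> spinor) p : spinor :=
  fun a => clifford c p (bvec 0) (spin_nabla c 1 psi p) a
           - clifford c p (bvec 1) (spin_nabla c 0 psi p) a.

End Spinors.

Section SphereMaps.
Context {R : realType} {M : surface R} {h : metric M} {S : spin_structure h}.

Definition smooth_to_sphere n (W : set M) (phi : 'I_n.+1 -> M -> R) : Prop :=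
  (forall i, smooth_on W (phi i)) /\
  forall p, W p -> \sum_i phi i p ^+ 2 = 1.

Definition smooth_twisted_section n (W : set M) (phi : 'I_n.+1 -> M -> R)
    (psi : 'I_n.+1 -> M -> spinor S) : Prop :=
  (forall i, smooth_section W (psi i)) /\
  forall p a, W p -> sdom a p ->
    \sum_i (phi i p)%:C *: psi i p a = 0.

Definition current n (c : chart R M) (phi : 'I_n.+1 -> M -> R)
    (psi : 'I_n.+1 -> M -> spinor S) (k : 'I_2) (i m : 'I_n.+1) (p : M) : R :=
  complex.Re (herm p (clifford c p (bvec k) (psi i p)) (psi m p))
  + (pd c k (phi i) p * phi m p - phi i p * pd c k (phi m) p).

End SphereMaps.

(* Main.v *)
Require Import Defs.
From HB Require Import structures.
From mathcomp Require Import all_boot all_order all_algebra.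
From mathcomp Require Import ring lra complex.
From mathcomp Require Import all_classical all_reals all_analysis.

Set Implicit Arguments.
Unset Strict Implicit.
Unset Printing Implicit Defensive.

Import Order.TTheory GRing.Theory Num.Theory.
Import numFieldNormedType.Exports.

Local Open Scope classical_set_scope.
Local Open Scope ring_scope.
Local Open Scope complex_scope.

(* In an orthonormal frame e_1, e_2 of a local trivialization, the spinorial part
   of J_k is sum_j w_kj Re <e_j psi^i, psi^m> with the coframe
   w_kj = h(d_k, e_j). Differentiating produces the derivatives of the spinors,
   which are the derivative terms of the right-hand side because Clifford
   multiplication is skew, and the exterior derivative of the coframe. By
   Cartan's first structure equation, which follows from the metric and
   torsion-free properties of the Christoffel symbols, the latter is exactly the
   contribution of the connection terms, whose commutator with e_j is
   - sum_b om_jb e_b. For the map part, the second derivatives of phi cancel by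
   the symmetry of mixed partials, and the products J_x J_y simplify with
   |phi| = 1, sum_j phi^j d phi^j = 0 and sum_j phi^j psi^j = 0. *)

Section SymmetricDerivatives.
Context {R : realType} {V : normedModType R}.
Implicit Types (f : V -> R) (x u v : V).

Lemma is_derive_line f x u (a : R) : derivable f (x + a *: u) u ->
  is_derive a 1 (fun t : R => f (x + t *: u)) ('D_u f (x + a *: u)).
Proof.
rewrite /derivable => df.
have E : (fun h : R => h^-1 *: (((fun t : R => f (x + t *: u)) \o shift a)
            (h *: 1) - f (x + a *: u))) =
         (fun h : R => h^-1 *: ((f \o shift (x + a *: u)) (h *: u)
            - f (x + a *: u))).
  apply/funext => h /=; congr (_ *: (f _ - _)).
  by rewrite scalerDl [_%:A]mulr1 addrCA.
by split; rewrite /derivable /derive E.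
Qed.

Lemma MVT_line f x u (s : R) : 0 < s ->
  (forall a, a \in `[0%R, s] -> derivable f (x + a *: u) u) ->
  exists2 a, a \in `]0, s[ & f (x + s *: u) - f x = s * 'D_u f (x + a *: u).
Proof.
move=> s0 df.
have [| |a a0s E] := @MVT R (fun t => f (x + t *: u))
    (fun a => 'D_u f (x + a *: u)) 0 s s0.
- move=> a a0s; apply: is_derive_line; apply: df.
  by apply: subset_itv_oo_cc a0s.
- apply: derivable_within_continuous => a a0s.
  by have [] := is_derive_line (df a a0s).
- by exists a => //; move: E; rewrite scale0r addr0 subr0 mulrC.
Qed.

Lemma second_difference f x u v (s : R) : 0 < s ->
  (forall a b, a \in `[0%R, s] -> b \in `[0%R, s] ->
    derivable f (x + a *: u + b *: v) u /\
    derivable ('D_u f) (x + a *: u + b *: v) v) ->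
  exists a b, [/\ a \in `[0%R, s], b \in `[0%R, s] &
    f (x + s *: u + s *: v) - f (x + s *: u) - f (x + s *: v) + f x
    = s * (s * 'D_v ('D_u f) (x + a *: u + b *: v))].
Proof.
move=> s0 df.
have s0s : s \in `[0%R, s] by rewrite in_itv /= lexx ltW.
have z0s : (0 : R) \in `[0%R, s] by rewrite in_itv /= lexx ltW.
pose g (y : V) : R := f (y + s *: v) - f y.
have dg a : a \in `[0%R, s] -> is_derive (x + a *: u) u g
    ('D_u f (x + a *: u + s *: v) - 'D_u f (x + a *: u)).
  move=> a0s.
  have [d1 _] := df a s a0s s0s; have [d2 _] := df a 0 a0s z0s.
  rewrite scale0r addr0 in d2.
  apply: is_deriveB; last exact: derivableP.
  have E : (fun h : R => h^-1 *: (((fun y => f (y + s *: v)) \o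
              shift (x + a *: u)) (h *: u) - f (x + a *: u + s *: v))) =
         (fun h : R => h^-1 *: ((f \o shift (x + a *: u + s *: v)) (h *: u)
            - f (x + a *: u + s *: v))).
    by apply/funext => h /=; congr (_ *: (f _ - _)); rewrite !addrA.
  by split; rewrite /derivable /derive E.
have [a' /dg []//|a aoo E] := @MVT_line g x u s s0.
have a0s : a \in `[0%R, s] by apply: subset_itv_oo_cc aoo.
have [b' b0s|b boo E2] := @MVT_line ('D_u f) (x + a *: u) v s s0.
  by have [] := df a b' a0s b0s.
exists a, b; split => //; first exact: subset_itv_oo_cc boo.
rewrite -E2.
have [_ <-] := dg a a0s; rewrite -E /g.
by rewrite opprB addrA [in RHS]addrAC -!addrA; congr (_ + (_ + _)); rewrite addrC.
Qed.

Lemma derive_comm f x u v :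
  (\forall y \near x, derivable f y u /\ derivable ('D_u f) y v) ->
  (\forall y \near x, derivable f y v /\ derivable ('D_v f) y u) ->
  {for x, continuous ('D_v ('D_u f))} ->
  {for x, continuous ('D_u ('D_v f))} ->
  'D_v ('D_u f) x = 'D_u ('D_v f) x.
Proof.
move=> duv dvu cuv cvu; apply/eqP; rewrite -subr_eq0 -normr_le0.
apply/ler_addgt0Pl => e e0; rewrite addr0.
have e20 : 0 < e / 2 by rewrite divr_gt0.
move/cvgrPdist_le: cuv => /(_ _ e20) nuv.
move/cvgrPdist_le: cvu => /(_ _ e20) nvu.
have [r1 /= r10 xr1] := (@nbhs_ballP R V x _).1 duv.
have [r2 /= r20 xr2] := (@nbhs_ballP R V x _).1 dvu.
have [r3 /= r30 xr3] := (@nbhs_ballP R V x _).1 nuv.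
have [r4 /= r40 xr4] := (@nbhs_ballP R V x _).1 nvu.
pose r := Num.min (Num.min r1 r2) (Num.min r3 r4).
have r0 : 0 < r by rewrite !lt_min r10 r20 r30 r40.
have xr y : ball x r y -> [/\ derivable f y u /\ derivable ('D_u f) y v,
      derivable f y v /\ derivable ('D_v f) y u,
      `|'D_v ('D_u f) x - 'D_v ('D_u f) y| <= e / 2 &
      `|'D_u ('D_v f) x - 'D_u ('D_v f) y| <= e / 2].
  move=> xy; split; [apply: xr1|apply: xr2|apply: xr3|apply: xr4];
    by apply: le_ball xy; rewrite !ge_min lexx ?orbT.
have k0 : 0 < `|u| + `|v| + 1 by rewrite ltr_wpDl ?addr_ge0.
pose s := r / 2 / (`|u| + `|v| + 1).
have s0 : 0 < s by rewrite !divr_gt0.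
have sr : s * (`|u| + `|v|) < r.
  have Es : s * (`|u| + `|v| + 1) = r / 2 by rewrite divfK ?gt_eqF.
  rewrite mulrDr mulr1 in Es; lra.
have sub a b : a \in `[0%R, s] -> b \in `[0%R, s] ->
    ball x r (x + a *: u + b *: v).
  rewrite !in_itv /= => /andP[a0 as_] /andP[b0 bs].
  rewrite -ball_normE /ball_ /= -!addrA opprD addrA subrr sub0r normrN.
  apply: le_lt_trans sr; apply: le_trans (ler_normD _ _) _.
  by rewrite !normrZ !ger0_norm// mulrDr lerD// ler_wpM2r.
have [|a [b [a0 b0 E]]] := @second_difference f x u v s s0.
  by move=> a b a0 b0; have [] := xr _ (sub a b a0 b0).
have sub' a' b' : a' \in `[0%R, s] -> b' \in `[0%R, s] ->
    ball x r (x + a' *: v + b' *: u) by move=> a'0 b'0; rewrite addrAC; apply: sub.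
have [|a' [b' [a'0 b'0 E']]] := @second_difference f x v u s s0.
  by move=> a' b' a'0 b'0; have [_ []] := xr _ (sub' a' b' a'0 b'0).
have EE : 'D_v ('D_u f) (x + a *: u + b *: v) =
          'D_u ('D_v f) (x + a' *: v + b' *: u).
  apply: (mulfI (lt0r_neq0 s0)); apply: (mulfI (lt0r_neq0 s0)).
  apply: etrans (esym E) (etrans _ E').
  by rewrite (addrAC x (s *: v)); congr (_ + _); exact: addrAC.
have [_ _ n1 _] := xr _ (sub a b a0 b0).
have [_ _ _ n2] := xr _ (sub' a' b' a'0 b'0).
rewrite EE in n1.
rewrite distrC; apply: le_trans (ler_distD ('D_u ('D_v f) (x + a' *: v + b' *: u)) _ _) _.
rewrite addrC.
by rewrite [e]splitr; apply: lerD; [rewrite distrC; exact: n1|exact: n2].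
Qed.

End SymmetricDerivatives.

Section PartialDerivatives.
Context {R : realType} {M : surface R} (c : chart R M) (k : 'I_2) (p : M).
Hypothesis c_p : cdom c p.
Implicit Types (f g : M -> R) (W : set M).

Definition is_pd f (df : R) : Prop :=
  is_derive (Defs.coord c p) (bvec k) (f \o cinv c) df.

Lemma pd_val f df : is_pd f df -> pd c k f p = df.
Proof. by case. Qed.

Lemma is_pd_pd_val f df : is_pd f df -> is_pd f (pd c k f p).
Proof. by move=> pf; rewrite (pd_val pf). Qed.

Lemma is_pd_cst a : is_pd (fun=> a) 0.
Proof. exact: is_derive_cst. Qed.

Lemma is_pdN f df : is_pd f df -> is_pd (fun q => - f q) (- df).
Proof. by move=> pf; apply: (@is_deriveN _ _ _ (f \o cinv c)). Qed.

Lemma is_pdD f g df dg : is_pd f df -> is_pd g dg ->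
  is_pd (fun q => f q + g q) (df + dg).
Proof. by move=> pf pg; apply: (@is_deriveD _ _ _ (f \o cinv c) (g \o cinv c)). Qed.

Lemma is_pdB f g df dg : is_pd f df -> is_pd g dg ->
  is_pd (fun q => f q - g q) (df - dg).
Proof. by move=> pf /is_pdN; apply: is_pdD. Qed.

Lemma is_pdM f g df dg : is_pd f df -> is_pd g dg ->
  is_pd (fun q => f q * g q) (df * g p + f p * dg).
Proof.
move=> pf pg; apply: is_derive_eq.
  exact: (@is_deriveM _ _ (f \o cinv c) (g \o cinv c) _ _ _ _ pf pg).
by rewrite /= coordK// addrC /GRing.scale /= (mulrC df).
Qed.

Lemma is_pd_sum n (f : 'I_n -> M -> R) (df : 'I_n -> R) :
  (forall i, is_pd (f i) (df i)) ->
  is_pd (fun q => \sum_i f i q) (\sum_i df i).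
Proof.
move=> pf; elim: n f df pf => [|n IH] f df pf.
  rewrite big_ord0 (_ : (fun q => _) = fun=> 0); first exact: is_pd_cst.
  by apply/funext => q; rewrite big_ord0.
rewrite big_ord_recl (_ : (fun q => _) =
    fun q => f ord0 q + \sum_i f (lift ord0 i) q).
  by apply: is_pdD => //; apply: IH.
by apply/funext => q; rewrite big_ord_recl.
Qed.

Lemma near_chart W : open W -> W p ->
  \forall y \near Defs.coord c p, W (cinv c y) /\ (Defs.coord c @` cdom c) y.
Proof.
move=> oW Wp; apply: filterI.
  apply: (cinv_continuous c_p); rewrite coordK//.
  exact: open_nbhs_nbhs.
by apply: open_nbhs_nbhs; split; [exact: cimg_open|exists p].
Qed.

Lemma eq_is_pd W f g df : open W -> W p ->
  (forall q, W q -> cdom c q -> f q = g q) -> is_pd f df -> is_pd g df.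
Proof.
move=> oW Wp fg; apply: near_eq_is_derive.
apply: filterS (near_chart oW Wp) => y [Wy [q cq qy]] /=.
by apply: fg => //; rewrite -qy coordK.
Qed.

Lemma smooth_is_pd W f : charts c -> smooth_on W f -> W p ->
  is_pd f (pd c k f p).
Proof.
move=> hc sf Wp; have [_ /(_ k) [df _]] := sf c hc 1.
by apply: derivableP; apply: df; exists p.
Qed.

End PartialDerivatives.

Section SecondPartialDerivatives.
Context {R : realType} {M : surface R} (c : chart R M) (p : M).
Hypotheses (c_chart : charts c) (c_p : cdom c p).
Variables (f : M -> R) (f_smooth : smooth_on (cdom c) f).

Let U : set 'rV[R]_2 := Defs.coord c @` (cdom c `&` cdom c).

Let nearU : \forall y \near Defs.coord c p, U y.
Proof.
apply: filterS (near_chart c_p (cdom_open c) c_p) => y [_].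
by rewrite /U setIid.
Qed.

Let pdE k y : U y -> pd c k f (cinv c y) = 'D_(bvec k) (f \o cinv c) y.
Proof. by rewrite /U setIid => -[q cq <-]; rewrite /pd !coordK. Qed.

Let C2 (i j : 'I_2) y : U y ->
  derivable (f \o cinv c) y (bvec i) /\
  derivable ('D_(bvec i) (f \o cinv c)) y (bvec j) /\
  {for y, continuous ('D_(bvec j) ('D_(bvec i) (f \o cinv c)))}.
Proof.
move=> Uy; have [_ /(_ i) [d1 [_ /(_ j) [d2 [d3 _]]]]] := f_smooth c_chart 2.
by split; [exact: d1|split; [exact: d2|exact: d3]].
Qed.

Lemma is_pd_pd i j : is_pd c j p (pd c i f) (pd c j (pd c i f) p).
Proof.
apply: derivableP.
have Up : U (Defs.coord c p) by exists p.
have [_ [d _]] := C2 i j Up.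
apply: near_eq_derivable d.
by apply: filterS nearU => y Uy /=; rewrite pdE.
Qed.

Lemma pd_comm i j : pd c j (pd c i f) p = pd c i (pd c j f) p.
Proof.
have Up : U (Defs.coord c p) by exists p.
have E i' j' : pd c j' (pd c i' f) p =
    'D_(bvec j') ('D_(bvec i') (f \o cinv c)) (Defs.coord c p).
  apply: near_eq_derive.
  by apply: filterS nearU => y Uy /=; rewrite pdE.
rewrite !E; apply: derive_comm.
- by apply: filterS nearU => y Uy; have [d1 [d2 _]] := C2 i j Uy.
- by apply: filterS nearU => y Uy; have [d1 [d2 _]] := C2 j i Uy.
- by have [_ []] := C2 i j Up.
- by have [_ []] := C2 j i Up.
Qed.

End SecondPartialDerivatives.

Section LeviCivitaAlgebra.
Context {R : realType}.
Variables (G F : 'M[R]_2) (dG dF : 'I_2 -> 'M[R]_2).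
Hypotheses (G_sym : G^T = G) (F_orthonormal : F *m G *m F^T = 1%:M).
Hypothesis dG_sym : forall k, (dG k)^T = dG k.
Hypothesis dF_orthonormal : forall k,
  dF k *m G *m F^T + F *m dG k *m F^T + F *m G *m (dF k)^T = 0.

Let chr (l i j : 'I_2) : R :=
  2^-1 * \sum_(m < 2) invmx G l m * (dG i m j + dG j m i - dG m i j).

Definition lc_frame k : 'M[R]_2 :=
  \matrix_(i, l) (dF k i l + \sum_(m < 2) chr l k m * F i m).

Definition lc_form k : 'M[R]_2 := lc_frame k *m G *m F^T.

(* Christoffel symbols of the first kind. *)
Let low k : 'M[R]_2 :=
  \matrix_(m, n) (2^-1 * (dG k n m + dG m n k - dG n k m)).

Lemma frame_dual : F^T *m F *m G = 1%:M.
Proof. by rewrite -mulmxA; apply: mulmx1C. Qed.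

Let G_unit : G \in unitmx.
Proof. by have [_ ->] := mulmx1_unit frame_dual. Qed.

Let chr_low k : (\matrix_(m, l) chr l k m) *m G = low k.
Proof.
have Gs a b : G a b = G b a by rewrite -[in LHS]G_sym mxE.
apply/matrixP => m n; rewrite !mxE.
under eq_bigr => l _ do rewrite !mxE /chr -mulrA mulr_suml.
rewrite -mulr_sumr exchange_big /=; congr (_ * _).
under eq_bigr => r _.
  under eq_bigr => l _ do rewrite mulrAC.
  rewrite -mulr_suml.
  over.
rewrite /= (bigD1 n) //= [X in _ + X]big1 ?addr0 => [|r rn].
  suff -> : \sum_(l < 2) invmx G l n * G l n = 1 by rewrite mul1r.
  have /matrixP/(_ n n) := mulmxV G_unit; rewrite !mxE eqxx mulr1n => <-.
  by apply: eq_bigr => l _; rewrite mulrC Gs.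
suff -> : \sum_(l < 2) invmx G l r * G l n = 0 by rewrite mul0r.
have /matrixP/(_ n r) := mulmxV G_unit; rewrite !mxE eq_sym (negPf rn) mulr0n => e.
rewrite -[RHS]e.
by apply: eq_bigr => l _; rewrite mulrC Gs.
Qed.

Let lc_frameG k : lc_frame k *m G = dF k *m G + F *m low k.
Proof.
rewrite -chr_low mulmxA -mulmxDl; congr (_ *m _).
apply/matrixP => i l; rewrite !mxE; congr (_ + _).
by apply: eq_bigr => m _; rewrite !mxE mulrC.
Qed.

Lemma lc_form_skew k : (lc_form k)^T = - lc_form k.
Proof.
apply/eqP; rewrite -addr_eq0 addrC; apply/eqP; rewrite /lc_form.
have lowD : low k + (low k)^T = dG k.
  apply/matrixP => m n; rewrite !mxE.
  have dGs a b d : dG a b d = dG a d b by rewrite -[in LHS]dG_sym mxE.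
  by rewrite (dGs k n m) (dGs m n k) (dGs n k m); field.
have -> : lc_frame k *m G *m F^T = dF k *m G *m F^T + F *m low k *m F^T.
  by rewrite lc_frameG mulmxDl.
rewrite [X in _ + X]linearD /= !trmx_mul !trmxK G_sym !mulmxA.
rewrite -[RHS](dF_orthonormal k) -lowD mulmxDr [in RHS]mulmxDl.
by rewrite -!addrA; congr (_ + (_ + _)); rewrite addrC.
Qed.

(* First structure equation: the coframe is G F^T. *)
Lemma cartan_structure x y j :
  (dG x *m F^T + G *m (dF x)^T) y j - (dG y *m F^T + G *m (dF y)^T) x j
  = \sum_b (lc_form x j b * (G *m F^T) y b - lc_form y j b * (G *m F^T) x b).
Proof.
have E k l : \sum_b lc_form k j b * (G *m F^T) l b = (lc_frame k *m G) j l.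
  have -> : lc_frame k *m G = lc_form k *m (G *m F^T)^T.
    by rewrite trmx_mul trmxK G_sym /lc_form -!mulmxA (mulmxA F^T) frame_dual mulmx1.
  by rewrite [RHS]mxE; apply: eq_bigr => b _; rewrite [X in _ = _ * X]mxE.
rewrite sumrB !E !lc_frameG.
have T k l : (dG k *m F^T + G *m (dF k)^T) l j = (F *m dG k + dF k *m G) j l.
  have -> : dG k *m F^T + G *m (dF k)^T = (F *m dG k + dF k *m G)^T.
    by rewrite linearD /= !trmx_mul dG_sym G_sym.
  by rewrite mxE.
rewrite !T [X in X - _]mxE [X in _ - X]mxE.
rewrite [X in _ = X - _]mxE [X in _ = _ - X]mxE.
suff : (F *m dG x) j y - (F *m dG y) j x = (F *m low x) j y - (F *m low y) j x.
  by move=> e; rewrite opprD addrACA e; ring.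
rewrite !mxE -!sumrB; apply: eq_bigr => l _; rewrite -!mulrBr !mxE.
have dGs a b d : dG a b d = dG a d b by rewrite -[in LHS]dG_sym mxE.
by congr (_ * _); rewrite (dGs x l y) (dGs y l x) (dGs l x y); field.
Qed.

End LeviCivitaAlgebra.

Section MatrixPartialDerivatives.
Context {R : realType} {M : surface R} (c : chart R M) (k : 'I_2) (p : M).
Hypothesis c_p : cdom c p.

Definition is_pd_mx m n (A : M -> 'M[R]_(m, n)) (dA : 'M[R]_(m, n)) : Prop :=
  forall i j, is_pd c k p (fun q => A q i j) (dA i j).

Lemma is_pd_trmx m n (A : M -> 'M[R]_(m, n)) dA :
  is_pd_mx A dA -> is_pd_mx (fun q => (A q)^T) dA^T.
Proof.
move=> pA i j; rewrite mxE (_ : (fun q => _) = fun q => A q j i); first exact: pA.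
by apply/funext => q; rewrite mxE.
Qed.

Lemma is_pd_mulmx m n r (A : M -> 'M[R]_(m, n)) (B : M -> 'M[R]_(n, r)) dA dB :
  is_pd_mx A dA -> is_pd_mx B dB ->
  is_pd_mx (fun q => A q *m B q) (dA *m B p + A p *m dB).
Proof.
move=> pA pB i j; rewrite !mxE -big_split /=.
rewrite (_ : (fun q => _) = fun q => \sum_l A q i l * B q l j).
  by apply: is_pd_sum => l; apply: is_pdM.
by apply/funext => q; rewrite mxE.
Qed.

Definition is_pd_spinor n (u : M -> 'cV[R[i]]_n) (du : 'cV[R[i]]_n) : Prop :=
  forall l, is_pd c k p (fun q => complex.Re (u q l 0)) (complex.Re (du l 0)) /\
            is_pd c k p (fun q => complex.Im (u q l 0)) (complex.Im (du l 0)).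

Lemma Re_cdot (u v : 'cV[R[i]]_2) : complex.Re (cdot u v) =
  \sum_l (complex.Re (u l 0) * complex.Re (v l 0)
          + complex.Im (u l 0) * complex.Im (v l 0)).
Proof.
rewrite /cdot raddf_sum; apply: eq_bigr => l _.
by case: (u l 0) (v l 0) => a b [x y] /=; rewrite mulrN opprK.
Qed.

Lemma is_pd_Re_cdot (u v : M -> 'cV[R[i]]_2) du dv :
  is_pd_spinor u du -> is_pd_spinor v dv ->
  is_pd c k p (fun q => complex.Re (cdot (u q) (v q)))
    (complex.Re (cdot du (v p)) + complex.Re (cdot (u p) dv)).
Proof.
move=> pu pv; rewrite !Re_cdot -big_split /=.
rewrite (_ : (fun q => _) = fun q => \sum_l
    (complex.Re (u q l 0) * complex.Re (v q l 0)
     + complex.Im (u q l 0) * complex.Im (v q l 0))); last first.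
  by apply/funext => q; rewrite Re_cdot.
apply: is_pd_sum => l; rewrite addrACA.
have [[pur pui] [pvr pvi]] := (pu l, pv l).
by apply: is_pdD; apply: is_pdM.
Qed.

Lemma is_pd_spinor_mul m n (N : 'M[R[i]]_(m, n)) u du :
  is_pd_spinor u du -> is_pd_spinor (fun q => N *m u q) (N *m du).
Proof.
move=> pu l; rewrite mxE !raddf_sum /=.
have pcst a f df : is_pd c k p f df -> is_pd c k p (fun q => a * f q) (a * df).
  move=> pf; have := is_pdM c_p (is_pd_cst c k p a) pf.
  by rewrite mul0r add0r.
split.
- rewrite (_ : (fun q => _) = fun q => \sum_r
      (complex.Re (N l r) * complex.Re (u q r 0)
       - complex.Im (N l r) * complex.Im (u q r 0))).
    rewrite (eq_bigr (fun r => complex.Re (N l r) * complex.Re (du r 0)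
       - complex.Im (N l r) * complex.Im (du r 0))).
      by apply: is_pd_sum => r; have [pr pi] := pu r; apply: is_pdB; apply: pcst.
    by move=> r _; case: (N l r) (du r 0) => a b [].
  apply/funext => q; rewrite mxE raddf_sum; apply: eq_bigr => r _.
  by case: (N l r) (u q r 0) => a b [].
- rewrite (_ : (fun q => _) = fun q => \sum_r
      (complex.Re (N l r) * complex.Im (u q r 0)
       + complex.Im (N l r) * complex.Re (u q r 0))).
    rewrite (eq_bigr (fun r => complex.Re (N l r) * complex.Im (du r 0)
       + complex.Im (N l r) * complex.Re (du r 0))).
      by apply: is_pd_sum => r; have [pr pi] := pu r; apply: is_pdD; apply: pcst.
    by move=> r _; case: (N l r) (du r 0) => a b [x y] /=; rewrite [b * x]mulrC.
  apply/funext => q; rewrite mxE raddf_sum; apply: eq_bigr => r _.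
  by case: (N l r) (u q r 0) => a b [x y] /=; rewrite [b * x]mulrC.
Qed.

End MatrixPartialDerivatives.

Lemma sum_ord2 (V : nmodType) (f : 'I_2 -> V) : \sum_j f j = f 0 + f 1.
Proof.
by rewrite big_ord_recl big_ord1; congr (f _ + f _); apply/val_inj.
Qed.

Section CliffordAlgebra.
Context {R : realType}.
Implicit Types (u v : 'cV[R[i]]_2) (j : 'I_2).

Lemma Re_cdotDl u u' v :
  complex.Re (cdot (u + u') v) = complex.Re (cdot u v) + complex.Re (cdot u' v).
Proof.
by rewrite !Re_cdot -big_split; apply: eq_bigr => l _; rewrite mxE !raddfD /=; ring.
Qed.

Lemma Re_cdotZl (a : R) u v :
  complex.Re (cdot (a%:C *: u) v) = a * complex.Re (cdot u v).
Proof.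
rewrite !Re_cdot mulr_sumr; apply: eq_bigr => l _; rewrite mxE.
by case: (u l 0) => x y /=; ring.
Qed.

Lemma Re_cdotC u v : complex.Re (cdot u v) = complex.Re (cdot v u).
Proof. by rewrite !Re_cdot; apply: eq_bigr => l _; ring. Qed.

Lemma Re_cdotZr (a : R) u v :
  complex.Re (cdot u (a%:C *: v)) = a * complex.Re (cdot u v).
Proof. by rewrite Re_cdotC Re_cdotZl Re_cdotC. Qed.

Lemma Re_cdotDr u v v' :
  complex.Re (cdot u (v + v')) = complex.Re (cdot u v) + complex.Re (cdot u v').
Proof. by rewrite Re_cdotC Re_cdotDl !(Re_cdotC u). Qed.

Lemma Re_cdotNl u v : complex.Re (cdot (- u) v) = - complex.Re (cdot u v).
Proof. by rewrite -scaleN1r -(rmorphN1 (real_complex R)) Re_cdotZl mulN1r. Qed.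

Lemma Re_cdot_sum n (f : 'I_n -> R) (u : 'I_n -> 'cV[R[i]]_2) v :
  complex.Re (cdot (\sum_j (f j)%:C *: u j) v)
  = \sum_j f j * complex.Re (cdot (u j) v).
Proof.
rewrite (big_morph (fun w => complex.Re (cdot w v)) (id1 := 0) (op1 := +%R)).
- by apply: eq_bigr => j _; apply: Re_cdotZl.
- by move=> w w'; apply: Re_cdotDl.
- by rewrite Re_cdot big1 // => l _; rewrite mxE /= !mul0r addr0.
Qed.

Lemma Re_cdotNr u v : complex.Re (cdot u (- v)) = - complex.Re (cdot u v).
Proof. by rewrite Re_cdotC Re_cdotNl Re_cdotC. Qed.

Lemma Re_cdotBl u u' v :
  complex.Re (cdot (u - u') v) = complex.Re (cdot u v) - complex.Re (cdot u' v).
Proof. by rewrite Re_cdotDl Re_cdotNl. Qed.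

Lemma Re_cdotBr u v v' :
  complex.Re (cdot u (v - v')) = complex.Re (cdot u v) - complex.Re (cdot u v').
Proof. by rewrite Re_cdotDr Re_cdotNr. Qed.

Lemma Re_cdot_gamma j u v :
  complex.Re (cdot u (gamma j *m v)) = - complex.Re (cdot (gamma j *m u) v).
Proof.
rewrite !Re_cdot !big_ord_recl !big_ord0 !addr0.
rewrite (_ : lift ord0 ord0 = 1); last exact/val_inj.
have one1 : 1 + 1 = 0 :> 'I_2 by exact/val_inj.
have zero1 : ord0 + 1 = 1 :> 'I_2 by exact/val_inj.
case: j => -[|[|//]] hj.
  rewrite (_ : Ordinal hj = 0); last exact/val_inj.
  rewrite !gamma0E one1 zero1 /=.
  by case: (u _ 0) (v _ 0) (u _ 0) (v _ 0) => a b [? ?] [? ?] [? ?] /=; ring.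
rewrite (_ : Ordinal hj = 1); last exact/val_inj.
rewrite !gamma1E one1 zero1 /=.
by case: (u _ 0) (v _ 0) (u _ 0) (v _ 0) => a b [? ?] [? ?] [? ?] /=; ring.
Qed.

Lemma ord2_addK (k : 'I_2) : k + 1 + 1 = k.
Proof. by case: k => -[|[|//]] hk; apply/val_inj. Qed.

Lemma gammaK j u : gamma j *m (gamma j *m u) = - u.
Proof.
apply/matrixP => k l; rewrite [l]ord1 [RHS]mxE {l}.
case: j => -[|[|//]] hj.
  rewrite (_ : Ordinal hj = 0); last exact/val_inj.
  rewrite !gamma0E ord2_addK mulrA.
  by case: (u k 0) => a b; simpc.
rewrite (_ : Ordinal hj = 1); last exact/val_inj.
rewrite !gamma1E ord2_addK mulrA.
by case: k => -[|[|//]] hk /=; rewrite ?mul1r ?mulr1 mulN1r.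
Qed.

Lemma gamma_anticomm u : gamma 1 *m (gamma 0 *m u) = - (gamma 0 *m (gamma 1 *m u)).
Proof.
apply/matrixP => k l; rewrite [l]ord1 [RHS]mxE {l}.
rewrite gamma1E !gamma0E gamma1E ord2_addK.
by case: k => -[|[|//]] hk /=; rewrite ?mul1r ?mulN1r ?mulrN ?opprK.
Qed.

Definition connection_action (om : 'M[R]_2) u : 'cV[R[i]]_2 :=
  \sum_(a < 2) \sum_(b < 2) (4^-1 * om a b)%:C *: (gamma a *m (gamma b *m u)).

Lemma connection_actionE (om : 'M[R]_2) u : om^T = - om ->
  connection_action om u = (2^-1 * om 0 1)%:C *: (gamma 0 *m (gamma 1 *m u)).
Proof.
move=> skew.
have s a b : om a b = - om b a.
  by have /matrixP/(_ b a) := skew; rewrite !mxE.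
have d a : om a a = 0 by have e := s a a; lra.
rewrite /connection_action !sum_ord2 gamma_anticomm scalerN -scaleNr.
rewrite !d !mulr0 !scale0r add0r addr0 -scalerDl (s 1 0); congr (_ *: _).
by rewrite -rmorphN -rmorphD /=; congr (_%:C); field.
Qed.

(* The connection term Gamma is skew-Hermitian and
   [gamma_j, Gamma] = - sum_b om_jb gamma_b. *)
Lemma clifford_connection (om : 'M[R]_2) j u v : om^T = - om ->
  complex.Re (cdot (gamma j *m connection_action om u) v)
  + complex.Re (cdot (gamma j *m u) (connection_action om v))
  = - \sum_b om j b * complex.Re (cdot (gamma b *m u) v).
Proof.
move=> skew; have s a b : om a b = - om b a.
  by have /matrixP/(_ b a) := skew; rewrite !mxE.
have d a : om a a = 0 by have e := s a a; lra.
have K : complex.Re (cdot (gamma j *m u) (gamma 0 *m (gamma 1 *m v)))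
    = - complex.Re (cdot (gamma 0 *m (gamma 1 *m (gamma j *m u))) v).
  by rewrite !Re_cdot_gamma opprK gamma_anticomm Re_cdotNl.
rewrite !connection_actionE// -scalemxAr Re_cdotZl Re_cdotZr.
rewrite K -mulrDr sum_ord2 {K}.
case: j => -[|[|//]] hj.
  rewrite (_ : Ordinal hj = 0); last exact/val_inj.
  rewrite d mul0r add0r gammaK gamma_anticomm mulmxN gammaK opprK !Re_cdotNl.
  by field.
rewrite (_ : Ordinal hj = 1); last exact/val_inj.
rewrite d mul0r addr0 gammaK gamma_anticomm mulmxN gammaK (s 1 0) mulmxN.
by rewrite opprK !Re_cdotNl; field.
Qed.

End CliffordAlgebra.

(* B j, D l j, E l j, P l j, Q l j stand for the real parts of
   <e_j psi, eta>, <e_j d_l psi, eta>, <e_j psi, d_l eta>,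
   <e_j Gamma_l psi, eta>, <e_j psi, Gamma_l eta>, and w for the coframe. *)
Lemma curl_algebra (R : realType) (w D E P Q : 'I_2 -> 'I_2 -> R)
    (dw01 dw10 B : 'I_2 -> R) (om : 'I_2 -> 'M[R]_2) :
  (forall l i j, om l i j = - om l j i) ->
  (forall l j, P l j + Q l j = - \sum_b om l j b * B b) ->
  (forall j, dw01 j - dw10 j = \sum_b (om 0 j b * w 1 b - om 1 j b * w 0 b)) ->
  \sum_j (dw01 j * B j + w 1 j * (D 0 j + E 0 j))
  - \sum_j (dw10 j * B j + w 0 j * (D 1 j + E 1 j))
  = - (\sum_j w 0 j * (D 1 j + P 1 j) - \sum_j w 1 j * (D 0 j + P 0 j))
    + (- (\sum_j w 0 j * (E 1 j + Q 1 j)) - - (\sum_j w 1 j * (E 0 j + Q 0 j))).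
Proof.
move=> skew PQ cartan.
have diag l i : om l i i = 0 by have e := skew l i i; lra.
have {}PQ l j : P l j = - Q l j - \sum_b om l j b * B b.
  by rewrite -PQ [RHS]addrC addrK.
have {}cartan j :
    dw01 j = dw10 j + \sum_b (om 0 j b * w 1 b - om 1 j b * w 0 b).
  by rewrite -cartan [RHS]addrC subrK.
rewrite !sum_ord2 !PQ !cartan !sum_ord2 !diag !(skew _ 1 0); ring.
Qed.

Section SpinorCurrent.
Context {R : realType} {M : surface R} {h : metric M} {S : spin_structure h}.
Variables (c : chart R M) (c_chart : charts c).

Section AtPoint.
Variables (a : sidx S) (p : M).
Hypotheses (c_p : cdom c p) (a_p : sdom a p).

Let G := gmx h c p.
Let F := frame a c p.
Let dG k : 'M[R]_2 := \matrix_(i, j) pd c k (fun q => gmx h c q i j) p.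
Let dF k : 'M[R]_2 := \matrix_(i, j) pd c k (fun q => frame a c q i j) p.
Let om := lc_form G F dG dF.

Let W : set M := sdom a `&` cdom c.
Let W_open : open W. Proof. exact: openI (sdom_open a) (cdom_open c). Qed.
Let W_p : W p. Proof. by []. Qed.

Let is_pd_gmx k : is_pd_mx c k p (gmx h c) (dG k).
Proof. by move=> i j; rewrite mxE; apply: smooth_is_pd (gmx_smooth _ _ _ _) c_p. Qed.

Let is_pd_frame k : is_pd_mx c k p (frame a c) (dF k).
Proof. by move=> i j; rewrite mxE; apply: smooth_is_pd (frame_smooth _ _ _ _) W_p. Qed.

Let dG_sym k : (dG k)^T = dG k.
Proof.
apply/matrixP => i j; rewrite mxE -(pd_val (is_pd_gmx k j i)); apply: pd_val.
apply: (eq_is_pd c_p (cdom_open c) c_p _ (is_pd_gmx k i j)) => q cq _.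
by rewrite -[in LHS](gmx_sym h c_chart cq) mxE.
Qed.

Let F_orthonormal : F *m G *m F^T = 1%:M.
Proof. exact: frame_orthonormal. Qed.

Let dF_orthonormal k :
  dF k *m G *m F^T + F *m dG k *m F^T + F *m G *m (dF k)^T = 0.
Proof.
rewrite -mulmxDl.
have pF := is_pd_mulmx c_p (is_pd_mulmx c_p (is_pd_frame k) (is_pd_gmx k))
  (is_pd_trmx (is_pd_frame k)).
apply/matrixP => i j; rewrite [RHS]mxE.
have [_ <-] := pF i j; apply: pd_val.
apply: (eq_is_pd c_p W_open W_p _ (is_pd_cst c k p ((1%:M : 'M[R]_2) i j))).
by move=> q [aq cq] _; rewrite frame_orthonormal.
Qed.

Let om_skew k : (om k)^T = - om k.
Proof. by apply: lc_form_skew => //; apply: gmx_sym. Qed.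

Lemma inner_bvec q k (E : 'M[R]_2) j :
  inner h c q (bvec k) (row j E) = (gmx h c q *m E^T) k j.
Proof. by rewrite /inner -rowE tr_row !mxE; apply: eq_bigr => l _; rewrite !mxE. Qed.

Let is_pd_coframe l k j :
  is_pd c l p (fun q => inner h c q (bvec k) (row j (frame a c q)))
    ((dG l *m F^T + G *m (dF l)^T) k j).
Proof.
rewrite (_ : (fun q => _) = fun q => (gmx h c q *m (frame a c q)^T) k j).
  exact: (is_pd_mulmx c_p (is_pd_gmx l) (is_pd_trmx (is_pd_frame l)) k j).
by apply/funext => q; rewrite inner_bvec.
Qed.

Definition pd_spinor k (psi : M -> spinor S) : 'cV[R[i]]_2 :=
  \col_l (pd c k (fun q => complex.Re (psi q a l 0)) p
          +i* pd c k (fun q => complex.Im (psi q a l 0)) p).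

Lemma is_pd_spinor_section psi k : smooth_section (cdom c) psi ->
  is_pd_spinor c k p (fun q => psi q a) (pd_spinor k psi).
Proof.
move=> [_ s] l; have [sr si] := s a l.
by rewrite mxE; split; [apply: smooth_is_pd sr _|apply: smooth_is_pd si _].
Qed.

Lemma spin_nablaE k (psi : M -> spinor S) :
  spin_nabla c k psi p a = pd_spinor k psi + connection_action (om k) (psi p a).
Proof.
congr (_ + _); apply: eq_bigr => i _; apply: eq_bigr => j _; congr ((_ * _)%:C *: _).
rewrite /inner /om /lc_form.
rewrite (_ : lc_nabla _ _ _ _ _ = row i (lc_frame G F dG dF k)); last first.
  apply/rowP => l; rewrite !mxE; congr (_ + _).
    by congr (pd _ _ _ _); apply/funext => q; rewrite mxE.
  by apply: eq_bigr => m _; rewrite !mxE; congr (_ * _ * _);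
    apply: eq_bigr => r _; rewrite !mxE.
by rewrite -row_mul tr_row !mxE; apply: eq_bigr => l _; rewrite !mxE.
Qed.

Lemma Re_cdot_clifford q X (u : spinor S) v :
  complex.Re (cdot (clifford c q X u a) v) = \sum_j
    inner h c q X (row j (frame a c q)) * complex.Re (cdot (gamma j *m u a) v).
Proof.
rewrite /clifford sum_ord2 Re_cdotDl [RHS]sum_ord2.
by congr (_ + _); apply: Re_cdotZl.
Qed.

Definition spinor_current k (psi eta : M -> spinor S) q : R :=
  complex.Re (herm q (clifford c q (bvec k) (psi q)) (eta q)).

Lemma is_pd_spinor_current l k psi eta :
  smooth_section (cdom c) psi -> smooth_section (cdom c) eta ->
  is_pd c l p (spinor_current k psi eta)
    (\sum_j ((dG l *m F^T + G *m (dF l)^T) k j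
                * complex.Re (cdot (gamma j *m psi p a) (eta p a))
              + (G *m F^T) k j
                * (complex.Re (cdot (gamma j *m pd_spinor l psi) (eta p a))
                   + complex.Re (cdot (gamma j *m psi p a) (pd_spinor l eta))))).
Proof.
move=> spsi seta; pose f q := \sum_j
  inner h c q (bvec k) (row j (frame a c q))
  * complex.Re (cdot (gamma j *m psi q a) (eta q a)).
apply: (@eq_is_pd _ _ c l p c_p W f _ _ W_open W_p).
  move=> q [aq cq] _; rewrite /spinor_current (@hermE _ _ _ _ q a)//.
  - by rewrite Re_cdot_clifford.
  - by apply: clifford_spinor => //; apply: spsi.1.
  - exact: seta.1.
apply: is_pd_sum => j; rewrite -inner_bvec; apply: is_pdM => //.
apply: (is_pd_Re_cdot c_p); last exact: is_pd_spinor_section.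
exact: (is_pd_spinor_mul c_p (gamma j) (is_pd_spinor_section l spsi)).
Qed.

Let om_cartan x y j :
  (dG x *m F^T + G *m (dF x)^T) y j - (dG y *m F^T + G *m (dF y)^T) x j
  = \sum_b (om x j b * (G *m F^T) y b - om y j b * (G *m F^T) x b).
Proof. by apply: cartan_structure => //; apply: gmx_sym. Qed.

Lemma spinor_current_curl psi eta :
  smooth_section (cdom c) psi -> smooth_section (cdom c) eta ->
  pd c 0 (spinor_current 1 psi eta) p - pd c 1 (spinor_current 0 psi eta) p
  = - complex.Re (cdot (dirac_curl c psi p a) (eta p a))
    + complex.Re (cdot (psi p a) (dirac_curl c eta p a)).
Proof.
move=> spsi seta.
rewrite !(pd_val (is_pd_spinor_current _ _ spsi seta)).
have cn k l : complex.Re (cdot (clifford c p (bvec k) (spin_nabla c l psi p) a)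
      (eta p a)) = \sum_j (G *m F^T) k j
        * (complex.Re (cdot (gamma j *m pd_spinor l psi) (eta p a))
           + complex.Re (cdot (gamma j *m connection_action (om l) (psi p a)) (eta p a))).
  rewrite Re_cdot_clifford; apply: eq_bigr => j _.
  by rewrite inner_bvec spin_nablaE mulmxDr Re_cdotDl.
have cn' k l : complex.Re (cdot (psi p a)
      (clifford c p (bvec k) (spin_nabla c l eta p) a)) = - \sum_j (G *m F^T) k j
        * (complex.Re (cdot (gamma j *m psi p a) (pd_spinor l eta))
           + complex.Re (cdot (gamma j *m psi p a) (connection_action (om l) (eta p a)))).
  rewrite Re_cdotC Re_cdot_clifford -sumrN; apply: eq_bigr => j _.
  by rewrite inner_bvec spin_nablaE Re_cdotC Re_cdot_gamma Re_cdotDr mulrN.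
have dl : complex.Re (cdot (dirac_curl c psi p a) (eta p a)) = _ :=
  etrans (Re_cdotBl _ _ _) (congr2 (fun s t => s - t) (cn 0 1) (cn 1 0)).
have dr : complex.Re (cdot (psi p a) (dirac_curl c eta p a)) = _ :=
  etrans (Re_cdotBr _ _ _) (congr2 (fun s t => s - t) (cn' 0 1) (cn' 1 0)).
apply: etrans (esym (congr2 (fun s t => - s + t) dl dr)).
apply: (@curl_algebra R (fun k j => (G *m F^T) k j)
  (fun l j => complex.Re (cdot (gamma j *m pd_spinor l psi) (eta p a)))
  (fun l j => complex.Re (cdot (gamma j *m psi p a) (pd_spinor l eta)))
  (fun l j => complex.Re
     (cdot (gamma j *m connection_action (om l) (psi p a)) (eta p a)))
  (fun l j => complex.Re
     (cdot (gamma j *m psi p a) (connection_action (om l) (eta p a))))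
  _ _ (fun j => complex.Re (cdot (gamma j *m psi p a) (eta p a))) om).
- by move=> l i j; have /matrixP/(_ j i) := om_skew l; rewrite !mxE.
- by move=> l j; apply: clifford_connection.
- exact: om_cartan.
Qed.

End AtPoint.
Lemma Re_cdot_clifford_skew a p X (u v : spinor S) :
  complex.Re (cdot (u a) (clifford c p X v a))
  = - complex.Re (cdot (clifford c p X u a) (v a)).
Proof.
rewrite Re_cdotC !Re_cdot_clifford -sumrN; apply: eq_bigr => j _.
by rewrite -mulrN Re_cdotC Re_cdot_gamma.
Qed.

End SpinorCurrent.

Lemma current_algebra (R : realType) n (f d0 d1 : 'I_n -> R)
    (A0 A1 : 'I_n -> 'I_n -> R) (i m : 'I_n) :
  \sum_j f j ^+ 2 = 1 -> \sum_j f j * d0 j = 0 -> \sum_j f j * d1 j = 0 ->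
  \sum_j A0 i j * f j = 0 -> \sum_j f j * A0 j m = 0 ->
  \sum_j A1 i j * f j = 0 -> \sum_j f j * A1 j m = 0 ->
  \sum_j ((- A0 i j + (d0 i * f j - f i * d0 j))
            * (- A1 j m + (d1 j * f m - f j * d1 m))
          - (- A1 i j + (d1 i * f j - f i * d1 j))
            * (- A0 j m + (d0 j * f m - f j * d0 m)))
  = \sum_j (A0 i j * A1 j m - A1 i j * A0 j m
            - A0 i j * d1 j * f m + A1 j m * f i * d0 j
            + A1 i j * d0 j * f m - A0 j m * f i * d1 j)
    - (d0 i * d1 m - d1 i * d0 m).
Proof.
move=> ff fd0 fd1 A0f fA0 A1f fA1.
rewrite [RHS]addrC; apply/eqP; rewrite -subr_eq -sumrB; apply/eqP.
rewrite (eq_bigr (fun j => A0 i j * f j * d1 m - A1 i j * f j * d0 m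
   - f j * A1 j m * d0 i + f j * A0 j m * d1 i
   + f j * d1 j * (d0 i * f m) - f j * d0 j * (d1 i * f m)
   + f j * d0 j * (f i * d1 m) - f j * d1 j * (f i * d0 m)
   - f j ^+ 2 * (d0 i * d1 m - d1 i * d0 m))); last by move=> j _; ring.
rewrite 2!sumrB big_split sumrB 2!big_split 2!sumrB /= -!mulr_suml.
rewrite ff fd0 fd1 A0f fA0 A1f fA1; ring.
Qed.

Theorem lemma3p7 (R : realType) (M : surface R) (h : metric M)
    (S : spin_structure h)
    (c : chart R M) (c_chart : charts c) (c_connected : connected (cdom c))
    (n : nat) (phi : 'I_n.+1 -> M -> R)
    (phi_sphere : smooth_to_sphere (cdom c) phi)
    (psi : 'I_n.+1 -> M -> spinor S)
    (psi_section : smooth_twisted_section (cdom c) phi psi)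
    (i m : 'I_n.+1) (p : M) (p_dom : cdom c p) :
  let x : 'I_2 := 0 in
  let y : 'I_2 := 1 in
  let Jc := current c phi psi in
  let d (k : 'I_2) (a : 'I_n.+1) : R := pd c k (phi a) p in
  let f (a : 'I_n.+1) : R := phi a p in
  let A (k : 'I_2) (a b : 'I_n.+1) : R :=
    complex.Re (herm p (psi a p) (clifford c p (bvec k) (psi b p))) in
  pd c x (Jc y i m) p - pd c y (Jc x i m) p
    - 2 * \sum_j (Jc x i j p * Jc y j m p - Jc y i j p * Jc x j m p)
  = - complex.Re (herm p (dirac_curl c (psi i) p) (psi m p))
    + complex.Re (herm p (psi i p) (dirac_curl c (psi m) p))
    - 2 * \sum_j (A x i j * A y j m - A y i j * A x j m
                  - A x i j * d y j * f m
                  + A y j m * f i * d x j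
                  + A y i j * d x j * f m
                  - A x j m * f i * d y j).
Proof.
move=> x y Jc d f A.
have [phi_smooth phi1] := phi_sphere; have [psi_smooth psi_phi] := psi_section.
pose a := projT1 (cid (sdom_cover S p)).
have a_p : sdom a p by rewrite /a; case: cid.
pose s k i m := spinor_current c k (psi i) (psi m).
have is_s k l j r : is_pd c l p (s k j r) (pd c l (s k j r) p).
  by apply: is_pd_pd_val; apply: (is_pd_spinor_current c_chart p_dom a_p).
have is_f k j : is_pd c k p (phi j) (d k j).
  exact: (smooth_is_pd k p_dom c_chart (phi_smooth j) p_dom).
have is_d k l j : is_pd c l p (pd c k (phi j)) (pd c l (pd c k (phi j)) p).
  exact: is_pd_pd.
have pdJ k l : pd c l (Jc k i m) p = pd c l (s k i m) p
    + ((pd c l (pd c k (phi i)) p * f m + d k i * d l m)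
       - (d l i * d k m + f i * pd c l (pd c k (phi m)) p)).
  by apply: pd_val; apply: is_pdD (is_s _ _ _ _) _; apply: is_pdB; apply: is_pdM.
have curl := spinor_current_curl c_chart p_dom a_p (psi_smooth i) (psi_smooth m).
have JE k j r : Jc k j r p = - A k j r + (d k j * f r - f j * d k r).
  congr (_ + _); apply: (canRL (@opprK _)); apply: esym.
  exact: (Re_cdot_clifford_skew c a p (bvec k) (psi j p) (psi r p)).
have orth z : \sum_j f j * complex.Re (cdot (psi j p a) z) = 0.
  by rewrite -Re_cdot_sum psi_phi // Re_cdot big1 // => l _;
    rewrite mxE /= !mul0r addr0.
have fA k : \sum_j A k i j * f j = 0 /\ \sum_j f j * A k j m = 0.
  split; last exact: orth.
  have e := orth (clifford c p (bvec k) (psi i p) a).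
  apply: etrans _ (etrans (congr1 -%R e) (oppr0 _)); rewrite -sumrN.
  apply: eq_bigr => j _; rewrite mulrC -mulrN.
  congr (_ * _); apply: etrans (Re_cdotC _ _) (canRL (@opprK _) _).
  exact: esym (Re_cdot_clifford_skew c a p (bvec k) (psi j p) (psi i p)).
have ff : \sum_j f j ^+ 2 = 1 by exact: phi1.
have fd k : \sum_j f j * d k j = 0.
  have := is_pd_sum (fun j => is_pdM p_dom (is_f k j) (is_f k j)).
  move/(eq_is_pd p_dom (cdom_open c) p_dom (g := fun=> 1)) => e.
  have {}e : \sum_j (d k j * f j + f j * d k j) = 0.
    rewrite -[LHS](pd_val (e _)); first exact: pd_val (is_pd_cst c k p 1).
    by move=> q cq _; rewrite -(phi1 q cq); apply: eq_bigr => j _; rewrite expr2.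
  rewrite big_split /= (eq_bigr (fun j => f j * d k j)) in e.
    by apply/eqP; move/eqP: e; rewrite -mulr2n mulrn_eq0.
  by move=> j _; apply: mulrC.
have alg := current_algebra ff (fd x) (fd y) (fA x).1 (fA x).2 (fA y).1 (fA y).2.
rewrite (eq_bigr (fun j =>
  (- A x i j + (d x i * f j - f i * d x j))
    * (- A y j m + (d y j * f m - f j * d y m))
  - (- A y i j + (d y i * f j - f i * d y j))
    * (- A x j m + (d x j * f m - f j * d x m)))); last first.
  by move=> j _; rewrite !JE.
rewrite alg !pdJ.
have combine (P Q X1 X0 Y T C : R) : P - Q = C -> X1 - X0 = - 2 * Y ->
    P + X1 - (Q + X0) - 2 * (T - Y) = C - 2 * T.
  by move=> <- e; rewrite -(subrK X0 X1) e; ring.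
apply: combine; first exact: curl.
rewrite (pd_comm c_chart p_dom (phi_smooth i) y x).
rewrite (pd_comm c_chart p_dom (phi_smooth m) y x).
move: (pd c y (pd c x (phi i)) p) (pd c y (pd c x (phi m)) p) => phixy_i phixy_m.
move: (f i) (f m) (d x i) (d y i) (d x m) (d y m) => f_i f_m dx_i dy_i dx_m dy_m.
ring.
Qed.
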